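(* Let $\Bbbk$ be an algebraically closed field of characteristic zero, let $\lambda\in\Bbbk$ with $\lambda\neq0$, let $\mathfrak U=\mathfrak U(\lambda)$ be the algebra presented in the context, with the elements $\phi_\pm,\psi_\pm$ defined there, and let $\mu\in\Bbbk^*$ with $\mu\neq1$. (1) The $\mathfrak U$-modules $$M_+(\mu):=\mathfrak U/\mathfrak U(\phi_+,\ g-\mu),\qquad M_-(\mu):=\mathfrak U/\mathfrak U(\phi_-,\ g-\mu)$$ are simple, with $\mathrm{ann}_{\mathfrak U}(M_+(\mu))=\langle\phi_+\rangle$ and $\mathrm{ann}_{\mathfrak U}(M_-(\mu))=\langle\phi_-\rangle$. (2) The $\mathfrak U$-modules $$V_+(\mu):=\mathfrak U/\mathfrak U(\psi_+,\ g+\mu),\qquad V_-(\mu):=\mathfrak U/\mathfrak U(\psi_-,\ g+\mu)$$ are simple, with $\mathrm{ann}_{\mathfrak U}(V_+(\mu))=\langle\psi_+\rangle$ and $\mathrm{ann}_{\mathfrak U}(V_-(\mu))=\langle\psi_-\rangle$.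
   Context: $\Bbbk^*=\Bbbk\setminus\{0\}$. $\mathfrak U(\lambda)$ is the associative unital $\Bbbk$-algebra generated by $g^{\pm1},x,y$ with relations $gg^{-1}=g^{-1}g=1$, $gxg^{-1}=x$, $gyg^{-1}=y+x$, $yx-xy=-\tfrac12x^2+\lambda(1-g^2)$. Fix a square root $\sqrt{2\lambda}\in\Bbbk$ and put $\phi_\pm=x\pm\sqrt{2\lambda}(g-1)$, $\psi_\pm=x\pm\sqrt{2\lambda}(g+1)$. Modules are left modules; $\mathfrak U(a,b)=\mathfrak Ua+\mathfrak Ub$ denotes the left ideal generated by $a,b$; $\langle a\rangle$ denotes the two-sided ideal generated by $a$; $\mathrm{ann}_{\mathfrak U}(M)=\{r\in\mathfrak U\mid rm=0\ \text{for all } m\in M\}$. *)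

(* Defs.v *)
From HB Require Import structures.
From mathcomp Require Import all_boot all_algebra.
From mathcomp Require Import boolp classical_sets.
From mathcomp Require Import monalg.

Set Implicit Arguments.
Unset Strict Implicit.
Unset Printing Implicit Defensive.

Import GRing.Theory.

Local Open Scope classical_set_scope.
Local Open Scope quotient_scope.
Local Open Scope ring_scope.

Section Ideals.
Variable R : pzRingType.

Definition two_sided_ideal (I : set R) : Prop :=
  [/\ I 0, forall u v, I u -> I v -> I (u - v),
      forall r u, I u -> I (r * u) & forall r u, I u -> I (u * r)].

Definition ideal_gen (A : set R) : set R := smallest two_sided_ideal A.

Lemma ideal_gen_two_sided A : two_sided_ideal (ideal_gen A).
Proof.
split.
- by move=> I [[]].
- move=> u v Hu Hv I HI; have [[_ B _ _] _] := HI.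
  by apply: B; [exact: Hu|exact: Hv].
- move=> r u Hu I HI; have [[_ _ B _] _] := HI.
  by apply: B; exact: Hu.
- move=> r u Hu I HI; have [[_ _ _ B] _] := HI.
  by apply: B; exact: Hu.
Qed.

(* Boolean-valued, so that the quotient types of ring_quotient apply. *)
Definition left_ideal2 (a b : R) : {pred R} :=
  fun r => `[< exists u v : R, r = u * a + v * b >].

Lemma left_ideal2_zmod_closed a b : zmod_closed (left_ideal2 a b).
Proof.
split; first by apply/asboolP; exists 0, 0; rewrite !mul0r addr0.
move=> _ _ /asboolP[u1 [v1 ->]] /asboolP[u2 [v2 ->]].
by apply/asboolP; exists (u1 - u2), (v1 - v2); rewrite !mulrBl opprD addrACA.
Qed.

HB.instance Definition _ a b :=
  GRing.isZmodClosed.Build R (left_ideal2 a b) (left_ideal2_zmod_closed a b).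

Lemma left_ideal2Ml a b r u : u \in left_ideal2 a b -> r * u \in left_ideal2 a b.
Proof.
move=> /asboolP[u1 [v1 ->]]; apply/asboolP.
by exists (r * u1), (r * v1); rewrite mulrDr !mulrA.
Qed.

End Ideals.

(* The left R-module R / (R a + R b). *)
Definition quot_left_ideal2 (R : pzRingType) (a b : R) : Type :=
  Quotient.quot (left_ideal2 a b).

Section QuotientModule.
Variables (R : pzRingType) (a b : R).
Local Notation Q := (quot_left_ideal2 a b).

HB.instance Definition _ := ZmodQuotient.copy Q (Quotient.quot (left_ideal2 a b)).

Definition quot_scale (r : R) (m : Q) : Q := \pi_Q (r * repr m).

Lemma quot_eq u v : (\pi_Q u == \pi_Q v) = (u - v \in left_ideal2 a b).
Proof. by rewrite Quotient.idealrBE. Qed.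

Lemma quot_scale_pi r u : quot_scale r (\pi_Q u) = \pi_Q (r * u).
Proof.
apply/eqP; rewrite /quot_scale quot_eq -mulrBr left_ideal2Ml //.
by rewrite -quot_eq reprK.
Qed.

Lemma quot_scaleA r s m : quot_scale r (quot_scale s m) = quot_scale (r * s) m.
Proof.
by elim/quotW: m => u; rewrite (quot_scale_pi s) (quot_scale_pi r) quot_scale_pi mulrA.
Qed.

Lemma quot_scale1 : left_id 1 quot_scale.
Proof. by elim/quotW=> u; rewrite quot_scale_pi mul1r. Qed.

Lemma quot_scaleDr : right_distributive quot_scale +%R.
Proof.
move=> r; elim/quotW=> u; elim/quotW=> v.
by rewrite -[\pi_Q u + _]raddfD !quot_scale_pi mulrDr raddfD.
Qed.

Lemma quot_scaleDl m : {morph quot_scale^~ m : r s / r + s}.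
Proof. by elim/quotW: m => u r s; rewrite !quot_scale_pi mulrDl raddfD. Qed.

HB.instance Definition _ := GRing.Zmodule_isLmodule.Build R Q
  quot_scaleA quot_scale1 quot_scaleDr quot_scaleDl.

End QuotientModule.

Definition simple_module (R : pzRingType) (M : lmodType R) : Prop :=
  (exists m : M, m != 0) /\
  forall N : set M, submod_closed [in N] -> N = [set 0] \/ N = setT.

Definition annihilator (R : pzRingType) (M : lmodType R) : set R :=
  [set r | forall m : M, r *: m = 0].

Section FreeAlgebra.

Inductive generator := Gen_g | Gen_ginv | Gen_x | Gen_y.

HB.instance Definition _ := gen_eqMixin generator.
HB.instance Definition _ := gen_choiceMixin generator.

Variable k : fieldType.

(* The free algebra k<g, g^-1, x, y>: the algebra of the free monoid. *)
Definition free_alg : Type := {malg k[{fmonom generator}]}.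
HB.instance Definition _ :=
  GRing.Lalgebra.copy free_alg {malg k[{fmonom generator}]}.

Definition fgen (i : generator) : free_alg := << fmu i >>.

Lemma free_scalerAr (c : k) (u v : free_alg) : c *: (u * v) = u * (c *: v).
Proof.
suff cC (w : free_alg) : w * (c%:MP : {malg k[{fmonom generator}]}) = c *: w.
  by rewrite -!cC mulrA.
rewrite malgM_def fgmulgU malgZ_def; apply: eq_bigr => m _.
by rewrite mulm1 mulrC.
Qed.

HB.instance Definition _ :=
  GRing.Lalgebra_isAlgebra.Build k free_alg free_scalerAr.

End FreeAlgebra.

Section U.
Variables (k : fieldType) (lam : k).
Local Notation F := (free_alg k).
Local Notation g := (fgen k Gen_g).
Local Notation g' := (fgen k Gen_ginv).
Local Notation x := (fgen k Gen_x).
Local Notation y := (fgen k Gen_y).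

(* The differences of the two sides of the defining relations. *)
Definition U_relators : set F :=
  [set g * g' - 1; g' * g - 1; g * x * g' - x; g * y * g' - (y + x);
       (y * x - x * y) - (- (2^-1 *: x ^+ 2) + lam *: (1 - g ^+ 2))].

Definition U_ideal : {pred F} := fun f => `[< ideal_gen U_relators f >].

Lemma U_ideal_zmod_closed : zmod_closed U_ideal.
Proof.
have [I0 IB _ _] := ideal_gen_two_sided U_relators.
split; first exact/asboolP.
by move=> u v /asboolP Iu /asboolP Iv; apply/asboolP; apply: IB.
Qed.

HB.instance Definition _ :=
  GRing.isZmodClosed.Build F U_ideal U_ideal_zmod_closed.

Lemma U_idealMl r u : u \in U_ideal -> r * u \in U_ideal.
Proof.
have [_ _ I _] := ideal_gen_two_sided U_relators.
by move=> /asboolP Iu; apply/asboolP; apply: I.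
Qed.

Lemma U_idealMr r u : u \in U_ideal -> u * r \in U_ideal.
Proof.
have [_ _ _ I] := ideal_gen_two_sided U_relators.
by move=> /asboolP Iu; apply/asboolP; apply: I.
Qed.

(* The augmentation g, g^-1 |-> 1, x, y |-> 0, witnessing that U(lam) != 0. *)
Definition aug_gen (i : generator) : k :=
  match i with Gen_g | Gen_ginv => 1 | Gen_x | Gen_y => 0 end.

Definition aug_mon (m : {fmonom generator}) : k := \prod_(i <- m) aug_gen i.

Lemma aug_mon_mmorphism : mmorphism aug_mon.
Proof.
split; last by rewrite /aug_mon fm1 big_nil.
by move=> m n; rewrite /aug_mon fmM big_cat.
Qed.

HB.instance Definition _ :=
  isMultiplicative.Build {fmonom generator} k aug_mon aug_mon_mmorphism.

Definition aug : F -> k := mmap idfun aug_mon.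

Lemma augM : {morph aug : u v / u * v}.
Proof. exact: (@mmap_is_multiplicative _ _ _ idfun aug_mon).1. Qed.

Lemma aug_U_relators f : U_relators f -> aug f = 0.
Proof.
have aE i : aug (fgen k i) = aug_gen i.
  by rewrite /aug mmapU /= mul1r /aug_mon fmU big_seq1.
have aZ (c : k) (u : F) : aug (c *: u) = c * aug u by exact: mmap_is_linear.
have aD (u v : F) : aug (u + v) = aug u + aug v by exact: mmapD.
have aN (u : F) : aug (- u) = - aug u by exact: mmapN.
have a1 : aug 1 = 1 by exact: mmap1.
by case=> [[[[]|]|]|] ->;
  rewrite ?expr2 ?(aZ, aD, aN, augM, a1, aE) /=
    ?(mulr1, mulr0, mul0r, addr0, subrr, oppr0).
Qed.

Lemma U_ideal1 : 1 \notin U_ideal.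
Proof.
apply/negP => /asboolP /(_ [set f | aug f = 0]) /= a1.
suff /a1 /eqP : two_sided_ideal [set f | aug f = 0] /\
    U_relators `<=` [set f | aug f = 0].
  by rewrite /aug mmap1 oner_eq0.
split; last exact: aug_U_relators.
split=> /=.
- exact: mmap0.
- by move=> u v au av; rewrite /aug mmapB -!/(aug _) au av subrr.
- by move=> r u au; rewrite augM au mulr0.
- by move=> r u au; rewrite augM au mul0r.
Qed.

Definition U : Type := Quotient.quot U_ideal.

HB.instance Definition _ := ZmodQuotient.copy U (Quotient.quot U_ideal).

Lemma U_eq u v : (\pi_U u == \pi_U v) = (u - v \in U_ideal).
Proof. by rewrite Quotient.idealrBE. Qed.

Definition U_one : U := \pi_U 1.
Definition U_mul (u v : U) : U := \pi_U (repr u * repr v).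
Definition U_scale (c : k) (u : U) : U := \pi_U (c *: repr u).

Lemma U_mul_pi u v : U_mul (\pi_U u) (\pi_U v) = \pi_U (u * v).
Proof.
apply/eqP; rewrite U_eq -(subrKA (repr (\pi_U u) * v)) -mulrBr -mulrBl.
by apply: rpredD; [apply: U_idealMl|apply: U_idealMr]; rewrite -U_eq reprK.
Qed.

Lemma U_scale_pi c u : U_scale c (\pi_U u) = \pi_U (c *: u).
Proof.
apply/eqP; rewrite U_eq -scalerBr -mulr_algl U_idealMl //.
by rewrite -U_eq reprK.
Qed.

Lemma U_mulA : associative U_mul.
Proof.
elim/quotW=> u; elim/quotW=> v; elim/quotW=> w.
by rewrite (U_mul_pi v w) (U_mul_pi u v) !U_mul_pi mulrA.
Qed.

Lemma U_mul1l : left_id U_one U_mul.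
Proof. by elim/quotW=> u; rewrite U_mul_pi mul1r. Qed.

Lemma U_mul1r : right_id U_one U_mul.
Proof. by elim/quotW=> u; rewrite U_mul_pi mulr1. Qed.

Lemma U_mulDl : left_distributive U_mul +%R.
Proof.
elim/quotW=> u; elim/quotW=> v; elim/quotW=> w.
by rewrite -[\pi_U u + _]raddfD !U_mul_pi mulrDl raddfD.
Qed.

Lemma U_mulDr : right_distributive U_mul +%R.
Proof.
elim/quotW=> u; elim/quotW=> v; elim/quotW=> w.
by rewrite -[\pi_U v + _]raddfD !U_mul_pi mulrDr raddfD.
Qed.

Lemma U_one_neq0 : U_one != 0.
Proof. by rewrite -[0](raddf0 \pi_U) U_eq subr0 U_ideal1. Qed.

HB.instance Definition _ := GRing.Zmodule_isNzRing.Build U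
  U_mulA U_mul1l U_mul1r U_mulDl U_mulDr U_one_neq0.

Lemma U_scaleA b c u : U_scale b (U_scale c u) = U_scale (b * c) u.
Proof.
by elim/quotW: u => u; rewrite (U_scale_pi c) (U_scale_pi b) U_scale_pi scalerA.
Qed.

Lemma U_scale1 : left_id 1 U_scale.
Proof. by elim/quotW=> u; rewrite U_scale_pi scale1r. Qed.

Lemma U_scaleDr : right_distributive U_scale +%R.
Proof.
move=> c; elim/quotW=> u; elim/quotW=> v.
by rewrite -[\pi_U u + _]raddfD !U_scale_pi scalerDr raddfD.
Qed.

Lemma U_scaleDl u : {morph U_scale^~ u : b c / b + c}.
Proof. by elim/quotW: u => u b c; rewrite !U_scale_pi scalerDl raddfD. Qed.

HB.instance Definition _ := GRing.Zmodule_isLmodule.Build k U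
  U_scaleA U_scale1 U_scaleDr U_scaleDl.

Lemma U_scaleAl (c : k) (u v : U) : c *: (u * v) = (c *: u) * v.
Proof.
elim/quotW: u => u; elim/quotW: v => v.
by rewrite /GRing.mul /GRing.scale /= U_mul_pi !U_scale_pi U_mul_pi scalerAl.
Qed.

HB.instance Definition _ := GRing.Lmodule_isLalgebra.Build k U U_scaleAl.

Lemma U_scaleAr (c : k) (u v : U) : c *: (u * v) = u * (c *: v).
Proof.
elim/quotW: u => u; elim/quotW: v => v.
by rewrite /GRing.mul /GRing.scale /= U_mul_pi !U_scale_pi U_mul_pi scalerAr.
Qed.

HB.instance Definition _ := GRing.Lalgebra_isAlgebra.Build k U U_scaleAr.

Definition Ug : U := \pi_U g.
Definition Ux : U := \pi_U x.
Definition Uy : U := \pi_U y.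

End U.

(* Below, s stands for the fixed square root of 2 * lam. *)
Section SpecialElements.
Variables (k : fieldType) (lam s : k).

Definition phi_plus : U lam := Ux lam + s *: (Ug lam - 1).
Definition phi_minus : U lam := Ux lam - s *: (Ug lam - 1).
Definition psi_plus : U lam := Ux lam + s *: (Ug lam + 1).
Definition psi_minus : U lam := Ux lam - s *: (Ug lam + 1).

Definition M_plus (mu : k) : lmodType (U lam) :=
  quot_left_ideal2 phi_plus (Ug lam - mu%:A).
Definition M_minus (mu : k) : lmodType (U lam) :=
  quot_left_ideal2 phi_minus (Ug lam - mu%:A).
Definition V_plus (mu : k) : lmodType (U lam) :=
  quot_left_ideal2 psi_plus (Ug lam + mu%:A).
Definition V_minus (mu : k) : lmodType (U lam) :=
  quot_left_ideal2 psi_minus (Ug lam + mu%:A).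

End SpecialElements.

(* Main.v *)
Require Import Defs.
From mathcomp Require Import all_boot all_algebra.
From mathcomp Require Import boolp classical_sets functions.
From mathcomp Require Import monalg.
From mathcomp Require Import ring.
Set Implicit Arguments.
Unset Strict Implicit.
Unset Printing Implicit Defensive.
Import GRing.Theory.
Local Open Scope classical_set_scope.
Local Open Scope quotient_scope.
Local Open Scope ring_scope.

(** The four modules are instances of one: with [t = s] or [t = - s], with
    [e = 1] or [e = - 1], and with [nu = e * mu], each is the quotient of U by
    the left ideal generated by [theta = x + t (g - e)] and [g - nu], where [nu]
    is neither 0 nor [e].

    The element [theta] is normal: it commutes with g and x, and since
    [t^2 = 2 lam] and [e^2 = 1] the last defining relation becomes
    [theta y = (y + theta / 2 + t e) theta] (lemma [theta_y]). Hence [theta]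
    kills the whole module, and so does its two-sided ideal J. Modulo J the
    generator x is [- t (g - e)], and the element [h = 1 - e g^-1] satisfies
    [h y = (y - t e) h]: commuting h past y translates y by [t e].

    The generator v of the module is an eigenvector of h with eigenvalue
    [c = 1 - e / nu], which is not 0. So the module consists of the vectors
    f(y) v for polynomials f, and h sends f(y) v to c f(y - t e) v. Therefore
    [h - c] acts as c times the difference operator of step [t e]. In
    characteristic 0 this operator lowers the degree by exactly one and is
    surjective on polynomials ([coef_pdiff], [pdiff_surj]).

    - Simplicity: a nonzero element of a submodule is lowered by [h - c] to a
      nonzero multiple of v ([submodule_generator]).
    - Annihilator: up to a power of g^-1 on the right, every element is
      congruent modulo J to a polynomial P(y, h) with the powers of h on the
      right ([normal_form]). If it kills the module then P(y, c) v = 0, hence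
      P(y, c) = 0 and P is a multiple of [h - c]; as [h - c] is surjective, the
      cofactor kills the module too, and P = 0 by induction on the degree in h
      ([eval_yh_faithful]).

    All of this needs that v is not 0, that is, that the left ideal is proper.
    For this U is made to act on the right on the power series in [z = h - c],
    where [g - nu] takes values in the series without constant term
    ([U_left_ideal_proper]). *)

(** * Words and right actions of the free algebra *)

Section FreeAlgebra.
Variable k : fieldType.
Local Notation F := (free_alg k).
Local Notation mon := {fmonom generator}.

Lemma free_alg_ind (P : F -> Prop) :
  P 0 -> (forall u v, P u -> P v -> P (u + v)) ->
  (forall c (m : mon), P << c *g m >>) -> forall f, P f.
Proof.
move=> P0 PD Pm f; rewrite [f](monalgE (K := mon)).
by elim/big_rec: _ => // m u _; apply: PD.
Qed.

Lemma monomial_catE (c d : k) (m n : mon) :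
  (<< c *g m >> : F) * << d *g n >> = << c * d *g mmul m n >>.
Proof. exact: fgmulUU. Qed.

Lemma monomialZ (c : k) (m : mon) : << c *g m >> = c *: (<< m >> : F).
Proof. by apply/malgP => n; rewrite mcoeffZ !mcoeffU mulrnAr mulr1. Qed.

End FreeAlgebra.

Section WordInduction.
Variables (k : fieldType) (lam : k).
Local Notation U := (U lam).

Definition gen_U (i : generator) : U := \pi_U (fgen k i).

(** Words are built by appending letters, so a property stable under right
    multiplication by the generators holds on all of U. The side matters:
    [theta] meets the letters of a word from the left, and normal forms have
    their powers of h and g^-1 on the right. *)
Lemma U_ind (P : U -> Prop) :
  P 1 -> (forall u v, P u -> P v -> P (u + v)) ->
  (forall (c : k) u, P u -> P (c *: u)) ->
  (forall u i, P u -> P (u * gen_U i)) -> forall u, P u.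
Proof.
move=> P1 PD PZ PM; elim/quotW=> f.
elim/free_alg_ind: f => [|u v Pu Pv|c m].
- have <- : 0 *: (1 : U) = \pi_U 0 by rewrite scale0r raddf0.
  exact: (PZ 0 1 P1).
- by rewrite raddfD; apply: PD.
have -> : \pi_U << c *g m >> = c *: (\pi_U << m >> : U).
  by rewrite monomialZ; apply/esym; exact: U_scale_pi.
apply: PZ; rewrite -[m]fmK; elim/last_ind: {m}(fmonom_val m) => [|m i IHm].
  by rewrite -fmoneE; exact: P1.
have -> : << FMonom (rcons m i) >> = << FMonom m >> * fgen k i :> free_alg k.
  by rewrite monomial_catE mulr1 -cats1 [mmul _ _]fmmulE fmuE.
rewrite -(U_mul_pi lam); exact: (PM _ i IHm).
Qed.

End WordInduction.

(** These identities hold for every algebra acting on the right of a vector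
    space; they serve for the free algebra and then for U. *)
Section RightModuleLaws.
Variables (k : fieldType) (A : algType k) (W : lmodType k) (act : W -> A -> W).
Hypotheses (actD : forall w, {morph act w : u v / u + v})
  (actM : forall w u v, act w (u * v) = act (act w u) v)
  (actZ : forall w c u, act w (c *: u) = c *: act w u)
  (act1 : forall w, act w 1 = w).
Implicit Types (w : W) (g x y u v : A) (lam t e nu : k).

Lemma actN w u : act w (- u) = - act w u.
Proof. by rewrite -[- u](@scaleN1r k A) actZ scaleN1r. Qed.

Let actE := (actD, actN, actM, actZ, act1).

Lemma act_inverse_relator w u v : act w (u * v - 1) = act (act w u) v - w.
Proof. by rewrite !actE. Qed.

Lemma act_conj_relator w u v u' z :
  act w (u * v * u' - z) = act (act (act w u) v) u' - act w z.
Proof. by rewrite !actE. Qed.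

Lemma act_commutator_relator lam g x y (og ox oy : W -> W) :
  (forall w, act w g = og w) -> (forall w, act w x = ox w) ->
  (forall w, act w y = oy w) -> forall w,
  act w ((y * x - x * y) - (- (2^-1 *: x ^+ 2) + lam *: (1 - g ^+ 2)))
  = ox (oy w) - oy (ox w) - (- (2^-1 *: ox (ox w)) + lam *: (w - og (og w))).
Proof. by move=> gE xE yE w; rewrite !expr2 !actE !(gE, xE, yE). Qed.

(** The hypothesis says that [x + t (g - e)] acts by zero, so that an element
    of the left ideal acts through [g - nu] as last factor. *)
Lemma act_left_ideal w t e nu g x u v :
  (forall w, act w x = - t *: (act w g - e *: w)) ->
  act w (u * (x + t *: (g - e%:A)) + v * (g - nu%:A))
    = act (act w v) g - nu *: act w v.
Proof.
by move=> xE; rewrite !(actE, xE) scaleNr addNr add0r.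
Qed.

End RightModuleLaws.

Section RightAction.
Variables (k : fieldType) (T : Type).
Local Notation F := (free_alg k).
Local Notation W := (T -> k^o).
Variable op : generator -> W -> W.
Hypothesis opL : forall i c (u w : W), op i (c *: u + w) = c *: op i u + op i w.

Definition word_act (m : {fmonom generator}) (w : W) : W :=
  foldl (fun w i => op i w) w m.

(** Computed coordinate by coordinate: for fixed [w] and [n] the [n]-th
    coordinate is a scalar, so that the linear extension to the free algebra is
    [mmap] with values in [k]. *)
Definition free_act (w : W) (f : F) : W :=
  fun n => mmap idfun (fun m => word_act m w n) f.

Lemma word_actL m c (u w : W) :
  word_act m (c *: u + w) = c *: word_act m u + word_act m w.
Proof.
rewrite /word_act; elim: (fmonom_val m) u w => [|i s IHs] u w //=.
by rewrite opL IHs.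
Qed.

Lemma word_actM m n w : word_act (mmul m n) w = word_act n (word_act m w).
Proof. by rewrite /word_act fmM foldl_cat. Qed.

Lemma free_actD w f1 f2 : free_act w (f1 + f2) = free_act w f1 + free_act w f2.
Proof. by apply/funext => n; rewrite /free_act mmapD. Qed.

Lemma free_actB w f1 f2 : free_act w (f1 - f2) = free_act w f1 - free_act w f2.
Proof. by apply/funext => n; rewrite /free_act mmapB. Qed.

Lemma free_act_monomial w c m : free_act w << c *g m >> = c *: word_act m w.
Proof. by apply/funext => n; rewrite /free_act mmapU. Qed.

Lemma free_act0 w : free_act w 0 = 0.
Proof. by apply/funext => n; rewrite /free_act mmap0. Qed.

Lemma free_actL c u w f :
  free_act (c *: u + w) f = c *: free_act u f + free_act w f.
Proof.
elim/free_alg_ind: f => [|f1 f2 IH1 IH2|d m].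
- by rewrite !free_act0 scaler0 addr0.
- by rewrite !free_actD IH1 IH2 scalerDr addrACA.
- by rewrite !free_act_monomial word_actL scalerDr !scalerA mulrC.
Qed.

Lemma free_act0l f : free_act 0 f = 0.
Proof.
have := free_actL (-1) 0 0 f.
by rewrite scaler0 addr0 scaleN1r addNr.
Qed.

Lemma free_actZ w c f : free_act w (c *: f) = c *: free_act w f.
Proof.
elim/free_alg_ind: f => [|f1 f2 IH1 IH2|d m].
- by rewrite scaler0 free_act0 scaler0.
- rewrite scalerDr (free_actD w f1) (free_actD w (c *: f1)) scalerDr.
  exact: f_equal2 IH1 IH2.
- rewrite free_act_monomial monomialZ scalerA -monomialZ.
  by rewrite free_act_monomial scalerA.
Qed.

Lemma free_act1 w : free_act w 1 = w.
Proof.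
rewrite [X in free_act _ X](_ : _ = << mone >>) // free_act_monomial scale1r.
by rewrite /word_act fm1.
Qed.

Lemma free_act_gen w i : free_act w (fgen k i) = op i w.
Proof. by rewrite free_act_monomial scale1r /word_act fmU. Qed.

Lemma free_actM w f1 f2 : free_act w (f1 * f2) = free_act (free_act w f1) f2.
Proof.
elim/free_alg_ind: f2 => [|f f' IH IH'|c m].
- by rewrite mulr0 !free_act0.
- rewrite mulrDr (free_actD w) (free_actD (free_act w f1)).
  exact: f_equal2 IH IH'.
elim/free_alg_ind: f1 => [|f f' IH IH'|d m'].
- by rewrite mul0r free_act0 free_act0l.
- rewrite mulrDl (free_actD w (f * _)) (free_actD w f) -[free_act w f]scale1r.
  rewrite free_actL !scale1r; exact: f_equal2 IH IH'.
- rewrite monomial_catE !free_act_monomial word_actM -[d *: _]addr0 word_actL.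
  rewrite [word_act m 0](_ : _ = 0) ?addr0 ?scalerA 1?mulrC //.
  have := word_actL m (-1) 0 0.
  by rewrite scaler0 addr0 scaleN1r addNr.
Qed.

Variable lam : k.
Hypothesis op_relators : forall f, U_relators lam f -> forall w, free_act w f = 0.

(** The elements acting by zero form a two-sided ideal, so it is enough that
    the relators act by zero. *)
Lemma free_act_ideal w f : f \in U_ideal lam -> free_act w f = 0.
Proof.
move=> /asboolP /(_ [set f | forall w, free_act w f = 0]) If.
apply: (If _ w); split; last exact: op_relators.
split=> /=.
- exact: free_act0.
- by move=> u v Ku Kv w'; rewrite free_actB Ku Kv subrr.
- by move=> r u Ku w'; rewrite free_actM Ku.
- by move=> r u Ku w'; rewrite free_actM Ku free_act0l.
Qed.

End RightAction.

(** * A right action of U on power series *)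

(** A sequence [w] stands for the power series with coefficients [w n] in a
    variable z, and z stands for [h - c] with [c = 1 - e / nu]. Then g^-1 is
    multiplication by [e (1 - h) = nu^-1 - e z], which is invertible because its
    constant term is, x is multiplication by [- t (g - e)], and y is the
    derivation [- t e (c + z) d/dz]. The action is on the right, so that the
    operators compose in the order opposite to the products in U. *)
Section PowerSeriesModel.
Variables (k : fieldType) (lam t e nu : k).
Hypotheses (two_neq0 : 2 != 0 :> k) (t2E : t ^+ 2 = 2 * lam) (e2E : e ^+ 2 = 1)
  (nu_neq0 : nu != 0).
Local Notation W := (nat -> k^o).

Definition shift (w : W) : W := fun n => if n is m.+1 then w m else 0.

Definition ps_ginv (w : W) : W := nu^-1 *: w - e *: shift w.

(** Division by [nu^-1 - e z], solved for one coefficient after the other. *)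
Fixpoint ps_g (w : W) (n : nat) : k^o :=
  nu * w n + (if n is m.+1 then e * nu * ps_g w m else 0).

Definition ps_x (w : W) : W := - t *: (ps_g w - e *: w).

Definition ps_y (w : W) : W := fun n =>
  - (t * e) * ((1 - e / nu) * n.+1%:R * w n.+1 + n%:R * w n).

Definition ps_op (i : generator) : W -> W :=
  match i with
  | Gen_g => ps_g | Gen_ginv => ps_ginv | Gen_x => ps_x | Gen_y => ps_y
  end.

Let eeE : e * e = 1. Proof. by rewrite -expr2. Qed.

Lemma ps_gE w : ps_g w = nu *: w + (e * nu) *: shift (ps_g w).
Proof.
by apply/funext => -[|n]; rewrite !fctE /= ?scaler0.
Qed.

Lemma ps_ginvK w : ps_g (ps_ginv w) = w.
Proof.
apply/funext; elim=> [|n IHn]; rewrite /= ?IHn /ps_ginv !fctE /=.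
  by rewrite scaler0 subr0 addr0 -![_ *: _]/(_ * _) mulVKf.
rewrite -![_ *: _]/(_ * _) mulrBr mulVKf // [nu * (e * _)]mulrCA mulrA.
by rewrite subrK.
Qed.

Lemma ps_gK w : ps_ginv (ps_g w) = w.
Proof.
rewrite /ps_ginv [X in _ *: X](ps_gE w) scalerDr !scalerA mulVf // scale1r.
by rewrite mulrCA mulVf // mulr1 addrK.
Qed.

Lemma shiftL c (u w : W) : shift (c *: u + w) = c *: shift u + shift w.
Proof. by apply/funext => -[|n]; rewrite !fctE /= ?scaler0 ?addr0. Qed.

Lemma ps_gL c (u w : W) : ps_g (c *: u + w) = c *: ps_g u + ps_g w.
Proof.
apply/funext; elim=> [|n IHn]; rewrite /= ?IHn !fctE /= -![_ *: _]/(_ * _); ring.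
Qed.

Lemma ps_opL i c (u w : W) : ps_op i (c *: u + w) = c *: ps_op i u + ps_op i w.
Proof.
case: i => /=; first exact: ps_gL.
- apply/funext => n; rewrite /ps_ginv shiftL !fctE -![_ *: _]/(_ * _); ring.
- apply/funext => n; rewrite /ps_x ps_gL !fctE -![_ *: _]/(_ * _); ring.
- apply/funext => n; rewrite /ps_y !fctE -![_ *: _]/(_ * _); ring.
Qed.

(** The relation between g and y, conjugated so as to involve only the explicit
    inverse of g. *)
Lemma ps_y_ginv w : ps_ginv (ps_y w) = ps_y (ps_ginv w) + ps_x (ps_ginv w).
Proof.
apply/funext => n; rewrite /ps_x ps_ginvK /ps_ginv /ps_y !fctE /shift.
case: n => [|n]; rewrite -![_ *: _]/(_ * _).
  by field : eeE; rewrite nu_neq0.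
by field : eeE; rewrite nu_neq0.
Qed.

Lemma ps_opB i (u w : W) : ps_op i (u - w) = ps_op i u - ps_op i w.
Proof. by rewrite addrC -scaleN1r ps_opL scaleN1r addrC. Qed.

Lemma ps_opZ i c (u : W) : ps_op i (c *: u) = c *: ps_op i u.
Proof.
have op0 : ps_op i 0 = 0 by rewrite -[X in ps_op i X](subrr 0) ps_opB subrr.
by rewrite -[c *: u]addr0 ps_opL op0 addr0.
Qed.

Lemma ps_opD i (u w : W) : ps_op i (u + w) = ps_op i u + ps_op i w.
Proof. by rewrite -[u in LHS]scale1r ps_opL scale1r. Qed.

Lemma ps_y_g w : ps_y (ps_g w) = ps_g (ps_y w) + ps_g (ps_x w).
Proof.
rewrite -[LHS]ps_ginvK ps_y_ginv ps_gK.
exact: (ps_opD Gen_g).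
Qed.

Lemma ps_g_x w : ps_g (ps_x w) = ps_x (ps_g w).
Proof.
by rewrite [LHS](ps_opZ Gen_g) [X in _ *: X](ps_opB Gen_g) (ps_opZ Gen_g).
Qed.

(** Only the last relator takes a computation: moving y past [- t (g - e)]
    leaves [- t g x], and the rest is an identity between polynomials in g. *)
Lemma ps_op_relators f : U_relators lam f -> forall w, free_act ps_op w f = 0.
Proof.
have aD w' : {morph free_act ps_op w' : u v / u + v} by exact: free_actD.
have aM := free_actM ps_opL; have aZ := free_actZ ps_op.
have a1 := free_act1 ps_op; have aG := free_act_gen ps_op.
case=> [[[[]|]|]|] -> w.
- by rewrite (act_inverse_relator aD aM aZ a1) !aG /= ps_gK subrr.
- by rewrite (act_inverse_relator aD aM aZ a1) !aG /= ps_ginvK subrr.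
- by rewrite (act_conj_relator aD aM aZ) !aG /= -ps_g_x ps_gK subrr.
- by rewrite (act_conj_relator aD aM aZ) aD !aG /= ps_y_ginv ps_gK subrr.
- rewrite (act_commutator_relator aD aM aZ a1 lam
    (aG^~ Gen_g) (aG^~ Gen_x) (aG^~ Gen_y)) /=.
  have ps_gx (u : W) : ps_g (ps_x u) = - t *: (ps_g (ps_g u) - e *: ps_g u).
    exact: ps_g_x.
  have yx : ps_y (ps_x w) = ps_x (ps_y w) - t *: ps_g (ps_x w).
    rewrite [LHS](ps_opZ Gen_y) [X in _ *: X](ps_opB Gen_y) (ps_opZ Gen_y) /=.
    rewrite ps_y_g addrAC scalerDr; congr (_ + _).
    by rewrite scaleNr.
  have lamE : lam = 2^-1 * t ^+ 2 by rewrite t2E mulKf.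
  rewrite yx [in X in _ - (_ + X)]lamE [ps_x (ps_x w)]/ps_x !ps_gx.
  apply/funext => n; rewrite /ps_x !fctE -![_ *: _]/(_ * _).
  by rewrite [RHS](_ : _ = 0) //; field : eeE.
Qed.

Lemma ps_g_coef0 w : ps_g w 0 = nu * w 0%N.
Proof. by rewrite /= addr0. Qed.

End PowerSeriesModel.

(** * Relations and properness of the left ideal *)
Lemma conj_comm (R : pzRingType) (g g' u v : R) :
  g' * g = 1 -> g * u * g' = v -> g * u = v * g.
Proof. by move=> ginvK <-; rewrite -mulrA ginvK mulr1. Qed.

Lemma commutator_image (k : fieldType) (A B : algType k) (p : A -> B) (lam : k)
    (pD : {morph p : u v / u + v}) (pN : {morph p : u / - u})
    (pM : {morph p : u v / u * v}) (pZ : forall c u, p (c *: u) = c *: p u)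
    (p1 : p 1 = 1) (g x y : A) :
  p (y * x - x * y) = p (- (2^-1 *: x ^+ 2) + lam *: (1 - g ^+ 2)) ->
  p y * p x = p x * p y - 2^-1 *: p x ^+ 2 + lam *: (1 - p g ^+ 2).
Proof.
rewrite !expr2 !(pD, pN, pM, pZ, p1) => E.
by rewrite -addrA -E addrC subrK.
Qed.

Section Relations.
Variables (k : fieldType) (lam : k).
Local Notation U := (U lam).
Local Notation g := (Ug lam).
Local Notation g' := (gen_U lam Gen_ginv).
Local Notation x := (Ux lam).
Local Notation y := (Uy lam).

Lemma pi_relator f1 f2 : U_relators lam (f1 - f2) -> \pi_U f1 = \pi_U f2.
Proof.
move=> rel_f; apply/eqP; rewrite U_eq.
by apply/asboolP => I [_]; apply.
Qed.

Let piM (u v : free_alg k) : \pi_U (u * v) = \pi_U u * \pi_U v.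
Proof. by apply/esym; exact: U_mul_pi. Qed.
Let piZ (c : k) (u : free_alg k) : \pi_U (c *: u) = c *: \pi_U u.
Proof. by apply/esym; exact: U_scale_pi. Qed.

Let piD (u v : free_alg k) : \pi_U (u + v) = \pi_U u + \pi_U v.
Proof. exact: raddfD. Qed.
Let piN (u : free_alg k) : \pi_U (- u) = - \pi_U u.
Proof. exact: raddfN. Qed.

Local Notation fg := (fgen k Gen_g).
Local Notation fg' := (fgen k Gen_ginv).
Local Notation fx := (fgen k Gen_x).
Local Notation fy := (fgen k Gen_y).

Lemma U_gK : g * g' = 1.
Proof.
have : U_relators lam (fg * fg' - 1) by do 4!left.
by move=> /pi_relator; rewrite piM.
Qed.

Lemma U_ginvK : g' * g = 1.
Proof.
have : U_relators lam (fg' * fg - 1) by do 3!left; right.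
by move=> /pi_relator; rewrite piM.
Qed.

Lemma U_gx : g * x = x * g.
Proof.
have : U_relators lam (fg * fx * fg' - fx) by do 2!left; right.
move=> /pi_relator; rewrite !piM; exact: conj_comm U_ginvK.
Qed.

Lemma U_gy : g * y = (y + x) * g.
Proof.
have : U_relators lam (fg * fy * fg' - (fy + fx)) by left; right.
move=> /pi_relator; rewrite !piM piD; exact: conj_comm U_ginvK.
Qed.

Lemma U_yx : y * x = x * y - 2^-1 *: x ^+ 2 + lam *: (1 - g ^+ 2).
Proof.
have : U_relators lam ((fy * fx - fx * fy)
   - (- (2^-1 *: fx ^+ 2) + lam *: (1 - fg ^+ 2))) by right.
move=> /pi_relator; exact: commutator_image piD piN piM piZ _ _ _ _.
Qed.

End Relations.

Section Properness.
Variables (k : fieldType) (lam t e nu : k).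
Hypotheses (two_neq0 : 2 != 0 :> k) (t2E : t ^+ 2 = 2 * lam) (e2E : e ^+ 2 = 1)
  (nu_neq0 : nu != 0).
Local Notation W := (nat -> k^o).
Local Notation act := (free_act (ps_op t e nu)).
Local Notation U := (U lam).

Definition U_act (w : W) (u : U) : W := act w (repr u).

Lemma U_act_pi w f : U_act w (\pi_U f) = act w f.
Proof.
apply/eqP; rewrite -subr_eq0 -free_actB; apply/eqP.
apply: (free_act_ideal (ps_opL t e nu) (ps_op_relators two_neq0 t2E e2E nu_neq0)).
by rewrite -U_eq reprK.
Qed.

Lemma U_actD w u v : U_act w (u + v) = U_act w u + U_act w v.
Proof.
elim/quotW: u => u; elim/quotW: v => v.
by rewrite -[\pi_U u + _]raddfD !U_act_pi free_actD.
Qed.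

Lemma U_actM w u v : U_act w (u * v) = U_act (U_act w u) v.
Proof.
elim/quotW: u => u; elim/quotW: v => v.
by rewrite [X in U_act _ X]U_mul_pi !U_act_pi (free_actM (ps_opL t e nu)).
Qed.

Lemma U_actZ w c u : U_act w (c *: u) = c *: U_act w u.
Proof.
elim/quotW: u => u.
by rewrite [X in U_act _ X]U_scale_pi !U_act_pi free_actZ.
Qed.

Lemma U_act1 w : U_act w 1 = w.
Proof. by rewrite [LHS]U_act_pi free_act1. Qed.

Lemma U_act_gen w i : U_act w (gen_U lam i) = ps_op t e nu i w.
Proof. by rewrite U_act_pi free_act_gen. Qed.

(** If 1 were in the left ideal, the constant series 1 would be the image of
    some series under [g - nu]; but g multiplies constant terms by [nu]. *)
Lemma U_left_ideal_proper (u v : U) :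
  1 <> u * (Ux lam + t *: (Ug lam - e%:A)) + v * (Ug lam - nu%:A).
Proof.
move=> /(congr1 (U_act (fun _ => 1))).
rewrite U_act1 (act_left_ideal U_actD U_actM U_actZ U_act1).
  rewrite (U_act_gen _ Gen_g) [ps_op _ _ _ _]/= => /(congr1 (fun w => w 0%N)).
  rewrite !fctE ps_g_coef0 -[_ *: _]/(_ * _) subrr => /eqP.
  by rewrite oner_eq0.
by move=> w; rewrite (U_act_gen _ Gen_x) (U_act_gen _ Gen_g).
Qed.

End Properness.

(** * Finite differences of polynomials *)
Section FiniteDifference.
Variables (k : fieldType) (a : k).
Hypothesis char0 : [pchar k] =i pred0.
Hypothesis a_neq0 : a != 0.

Definition pshift (f : {poly k}) := f \Po ('X - a%:P).

Definition pdiff (f : {poly k}) := pshift f - f.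

Lemma pshift_MXaddC f c : pshift (f * 'X + c%:P) = pshift f * ('X - a%:P) + c%:P.
Proof. by rewrite /pshift comp_polyD comp_polyM comp_polyX comp_polyC. Qed.

Lemma pdiff_MXaddC f c :
  pdiff (f * 'X + c%:P) = pdiff f * 'X - a *: f - a *: pdiff f.
Proof. by rewrite /pdiff pshift_MXaddC -!mul_polyC; ring. Qed.

Lemma pdiffD f1 f2 : pdiff (f1 + f2) = pdiff f1 + pdiff f2.
Proof. by rewrite /pdiff /pshift comp_polyD; ring. Qed.

Lemma pdiffC c : pdiff c%:P = 0.
Proof. by rewrite /pdiff /pshift comp_polyC subrr. Qed.

(** The coefficient below the top one. Allowing [f] to have smaller degree than
    [n + 1] gives at once that the coefficients from the degree of [f] on
    vanish. *)
Lemma coef_pdiff (f : {poly k}) n :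
  (size f <= n.+2)%N -> (pdiff f)`_n = - (n.+1%:R * a * f`_n.+1).
Proof.
elim/poly_ind: f n => [|f c IHf] n size_f.
  by rewrite pdiffC !coef0 mulr0 oppr0.
have {}size_f : (size f <= n.+1)%N.
  move: size_f; rewrite size_MXaddC; case: ifP => // /andP[/eqP-> _].
  by rewrite size_poly0.
rewrite pdiff_MXaddC; move: (pdiff f) IHf => q IHf.
rewrite !(coefB, coefD, coefMX, coefZ, coefC) /= addr0 (IHf n) 1?ltnW //.
rewrite [f`_n.+1]nth_default //.
case: n => [|n] /= in size_f *; first by ring.
by rewrite (IHf n) //; ring.
Qed.

Lemma size_pdiff (f : {poly k}) n : (size f <= n.+1)%N -> (size (pdiff f) <= n)%N.
Proof.
move=> size_f; apply/leq_sizeP => m le_nm.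
have lt_fm : (size f <= m.+1)%N by apply: leq_trans size_f _.
by rewrite coef_pdiff 1?ltnW // nth_default // mulr0 oppr0.
Qed.

Lemma natS_neq0 n : n.+1%:R != 0 :> k.
Proof. by have /pcharf0P -> := char0. Qed.

Lemma pdiff_neq0 (f : {poly k}) : (1 < size f)%N -> pdiff f != 0.
Proof.
case size_f: (size f) => [|[|n]] // _.
apply/eqP => /(congr1 (fun q : {poly k} => q`_n)).
rewrite coef_pdiff ?size_f // coef0 => /eqP.
rewrite oppr_eq0 !mulf_eq0 (negPf (natS_neq0 n)) (negPf a_neq0) /=.
have -> : f`_n.+1 = lead_coef f by rewrite lead_coefE size_f.
by rewrite lead_coef_eq0 -size_poly_eq0 size_f.
Qed.

Lemma pdiff_surj f : exists F, pdiff F = f.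
Proof.
have [n] := ubnP (size f); elim: n f => // n IHn f; rewrite ltnS => size_f.
case: n => [|n] in IHn size_f *.
  by exists 0; rewrite pdiffC; apply/esym/eqP; rewrite -size_poly_eq0 -leqn0.
pose F0 := (- (f`_n / (n.+1%:R * a))) *: 'X^(n.+1).
have size_F0 : (size F0 <= n.+2)%N.
  by apply: leq_trans (size_scale_leq _ _) _; rewrite size_polyXn.
have [|F1 F1E] := IHn (f - pdiff F0).
  rewrite ltnS; apply/leq_sizeP => m; rewrite leq_eqVlt => /predU1P[<-|lt_nm].
    rewrite coefB coef_pdiff // coefZ coefXn eqxx mulr1.
    have := natS_neq0 n; move: n.+1%:R => b b_neq0.
    by field; rewrite a_neq0.
  have lt_fm : (size f <= m)%N by exact: leq_trans lt_nm.
  have lt_dm : (size (pdiff F0) <= m)%N.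
    by apply: leq_trans lt_nm; exact: size_pdiff.
  by rewrite coefB !nth_default // subrr.
by exists (F1 + F0); rewrite pdiffD F1E subrK.
Qed.

End FiniteDifference.

(** * Normality of theta *)

(** From here to the end of the section the only facts about U in use are the
    defining relations and induction on words, so [R] is any algebra with these
    properties. *)
Section Algebra.
Variables (k : fieldType) (R : algType k) (lam t e : k) (g g' x y : R).
Hypotheses (two_neq0 : 2 != 0 :> k) (t2E : t ^+ 2 = 2 * lam) (e2E : e ^+ 2 = 1).
Hypotheses (gK : g * g' = 1) (ginvK : g' * g = 1) (gx : g * x = x * g)
  (gy : g * y = (y + x) * g)
  (yx : y * x = x * y - 2^-1 *: x ^+ 2 + lam *: (1 - g ^+ 2)).
Hypothesis word_ind : forall P : R -> Prop,
  P 1 -> (forall u v, P u -> P v -> P (u + v)) ->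
  (forall (c : k) u, P u -> P (c *: u)) ->
  (forall u, P u -> [/\ P (u * g), P (u * g'), P (u * x) & P (u * y)]) ->
  forall u, P u.

Variables theta h : R.
Hypothesis thetaE : theta = x + t *: (g - e%:A).
Hypothesis hE : h = 1 - e *: g'.

Lemma ginv_x : g' * x = x * g'.
Proof.
by rewrite -[LHS]mulr1 -gK !mulrA -[_ * x * g]mulrA -gx mulrA ginvK mul1r.
Qed.

Lemma ginv_y : y * g' = g' * (y + x).
Proof.
by rewrite -[LHS]mul1r -ginvK -!mulrA [g * (y * g')]mulrA gy -mulrA gK mulr1.
Qed.

Lemma theta_comm z : x * z = z * x -> g * z = z * g -> theta * z = z * theta.
Proof.
move=> xz gz; rewrite thetaE mulrDl mulrDr -scalerAl -scalerAr mulrBl mulrBr.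
by rewrite xz gz mulr_algl mulr_algr.
Qed.

Lemma theta_g : theta * g = g * theta.
Proof. by apply: theta_comm => //; exact/esym. Qed.

Lemma theta_x : theta * x = x * theta.
Proof. exact: theta_comm. Qed.

Lemma theta_ginv : theta * g' = g' * theta.
Proof.
by apply: theta_comm; rewrite ?gK ?ginvK // ginv_x.
Qed.

(** With [p = x + t g] the left side is half of [(p + t e) (p - t e)], that is,
    half of [p^2 - t^2]. The right side is [theta y - y theta], which is how
    [theta_y] uses the identity. *)
Lemma half_theta : 2^-1 *: (theta + (2 * t * e)%:A) * theta
  = 2^-1 *: x ^+ 2 - lam *: (1 - g ^+ 2) + t *: (x * g).
Proof.
pose p := x + t *: g.
have thetaE' : theta = p - (t * e)%:A.
  by rewrite thetaE scalerBr scalerA addrA.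
have thetaE2 : theta + (2 * t * e)%:A = p + (t * e)%:A.
  rewrite thetaE' -addrA -scaleNr -scalerDl; congr (_ + _ *: _); ring.
have pC : GRing.comm p (t * e)%:A by rewrite /GRing.comm mulr_algl mulr_algr.
have p2 : p ^+ 2 = x ^+ 2 + (2 * t) *: (x * g) + t ^+ 2 *: g ^+ 2.
  rewrite /p !expr2 mulrDl !mulrDr -!scalerAl -!scalerAr gx scalerA -!addrA.
  by congr (_ + _); rewrite !addrA -scalerDl; congr (_ *: _ + _); ring.
rewrite thetaE2 thetaE' -scalerAl.
have -> : (p + (t * e)%:A) * (p - (t * e)%:A) = p ^+ 2 - (t ^+ 2)%:A.
  rewrite mulrDl !mulrBr pC addrA subrK expr2; congr (_ - _).
  rewrite -scalerAl mul1r scalerA; congr (_ *: _).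
  by rewrite mulrACA -!expr2 e2E mulr1.
have lamE : lam = 2^-1 * t ^+ 2 by rewrite t2E mulKf.
rewrite p2 !scalerBr !scalerDr !scalerA lamE.
have -> : 2^-1 * (2 * t) = t by rewrite mulKf.
by rewrite opprB -!addrA; congr (_ + _); rewrite [RHS]addrA [RHS]addrC.
Qed.

Lemma theta_y : theta * y = (y + 2^-1 *: (theta + (2 * t * e)%:A)) * theta.
Proof.
rewrite [RHS]mulrDl half_theta.
rewrite thetaE mulrDl mulrDr -scalerAl -scalerAr mulrBl mulrBr gy mulrDl.
rewrite mulr_algl mulr_algr yx.
move: (2^-1 *: x ^+ 2) (lam *: (1 - g ^+ 2)) => u v.
have -> : x * y - u + v = x * y - (u - v) by rewrite opprB addrA addrAC.
rewrite addrACA subrK -scalerDr -addrA; congr (_ + _ *: _).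
by rewrite addrA addrAC.
Qed.

Lemma theta_normal r : exists u, theta * r = u * theta.
Proof.
elim/word_ind: r => [|r s [u ru] [v sv]|c r [u ru]|r [u ru]].
- by exists 1; rewrite mulr1 mul1r.
- by exists (u + v); rewrite mulrDr ru sv mulrDl.
- by exists (c *: u); rewrite -scalerAr -scalerAl ru.
split; rewrite mulrA ru -mulrA.
- by exists (u * g); rewrite theta_g mulrA.
- by exists (u * g'); rewrite theta_ginv mulrA.
- by exists (u * x); rewrite theta_x mulrA.
- by rewrite theta_y mulrA; exists (u * (y + 2^-1 *: (theta + (2 * t * e)%:A))).
Qed.

(** In [h y] the commutator of g^-1 and y contributes [e g^-1 x], and
    [x = theta - t (g - e)] turns it into [e g^-1 theta - t e h]. *)
Lemma h_y : h * y = (y - (t * e)%:A) * h + e *: (g' * theta).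
Proof.
have g'y : g' * y = y * g' - g' * x by rewrite ginv_y mulrDr addrK.
have g'gE : g' * (g - e%:A) = h.
  by rewrite hE mulrBr ginvK mulr_algr.
rewrite thetaE mulrDr -scalerAr g'gE scalerDr scalerA (mulrBl h) mulr_algl.
rewrite [e * t]mulrC addrACA addNr addr0.
rewrite hE mulrBl mulrBr mul1r mulr1 -scalerAl -scalerAr g'y scalerBr.
by rewrite opprB addrA addrAC.
Qed.

Lemma xg'E : x * g' = theta * g' - t *: h.
Proof.
rewrite thetaE mulrDl -scalerAl mulrBl gK mulr_algl -hE addrK //.
Qed.

(** * Normal forms modulo theta *)
Local Notation J := (ideal_gen [set theta]).

Definition eval_y : {poly k} -> R := horner_alg y.

Lemma eval_yZ (a : k) (f : {poly k}) : eval_y (a *: f) = a *: eval_y f.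
Proof. by rewrite -mul_polyC /eval_y rmorphM /= horner_algC mulr_algl. Qed.

Lemma eval_yD (f1 f2 : {poly k}) : eval_y (f1 + f2) = eval_y f1 + eval_y f2.
Proof. exact: raddfD. Qed.

Lemma eval_yB (f1 f2 : {poly k}) : eval_y (f1 - f2) = eval_y f1 - eval_y f2.
Proof. exact: raddfB. Qed.

(** The indeterminate of the outer polynomials is h and that of the inner ones
    is y; y and h do not commute, and the powers of h stand on the right. *)
Definition eval_yh (P : {poly {poly k}}) : R := (map_poly eval_y P).[h].

Lemma eval_yh_MXaddC P f : eval_yh (P * 'X + f%:P) = eval_yh P * h + eval_y f.
Proof.
by rewrite /eval_yh rmorphD rmorphM /= map_polyX map_polyC hornerD hornerMX hornerC.
Qed.

Lemma eval_yhD P Q : eval_yh (P + Q) = eval_yh P + eval_yh Q.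
Proof. by rewrite /eval_yh rmorphD hornerD. Qed.

Lemma eval_yh_MX P : eval_yh (P * 'X) = eval_yh P * h.
Proof. by rewrite /eval_yh rmorphM /= map_polyX hornerMX. Qed.

Lemma eval_yhC f : eval_yh f%:P = eval_y f.
Proof. by rewrite /eval_yh map_polyC hornerC. Qed.

Lemma eval_yhZ c P : eval_yh (c%:P *: P) = c *: eval_yh P.
Proof.
by rewrite /eval_yh linearZ /= hornerZ /eval_y horner_algC mulr_algl.
Qed.

Lemma eval_yh_MXsubC Q (b : k) :
  eval_yh (Q * ('X - b%:P%:P)) = eval_yh Q * (h - b%:A).
Proof.
rewrite mulrBr [in RHS]mulrBr mulr_algr -eval_yhZ -eval_yh_MX -mul_polyC.
rewrite [_%:P * Q]mulrC.
by rewrite /eval_yh raddfB hornerD hornerN.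
Qed.

Definition has_normal_form r := exists P, J (r - eval_yh P).

Let J0 : J 0. Proof. by have [] := ideal_gen_two_sided [set theta]. Qed.
Let JB u v : J u -> J v -> J (u - v).
Proof. by have [_ + _ _] := ideal_gen_two_sided [set theta]; apply. Qed.
Let JMl r u : J u -> J (r * u).
Proof. by have [_ _ + _] := ideal_gen_two_sided [set theta]; apply. Qed.
Let JMr r u : J u -> J (u * r).
Proof. by have [_ _ _] := ideal_gen_two_sided [set theta]; apply. Qed.
Let JD u v : J u -> J v -> J (u + v).
Proof. by move=> Ju Jv; rewrite -[v]opprK -[- v]sub0r; do ! apply: JB. Qed.
Let J_theta : J theta. Proof. by move=> I [_]; apply. Qed.

Lemma has_normal_form_mod r s : J (r - s) -> has_normal_form s -> has_normal_form r.
Proof. by move=> Jrs [P JP]; exists P; rewrite -(subrKA s); apply: JD. Qed.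

Lemma has_normal_formD r s :
  has_normal_form r -> has_normal_form s -> has_normal_form (r + s).
Proof.
move=> [P JP] [Q JQ]; exists (P + Q).
by rewrite eval_yhD opprD addrACA; apply: JD.
Qed.

Lemma has_normal_formZ c r : has_normal_form r -> has_normal_form (c *: r).
Proof.
move=> [P JP]; exists (c%:P *: P).
by rewrite eval_yhZ -scalerBr -mulr_algl; apply: JMl.
Qed.

Lemma has_normal_form_h r : has_normal_form r -> has_normal_form (r * h).
Proof.
by move=> [P JP]; exists (P * 'X); rewrite eval_yh_MX -mulrBl; apply: JMr.
Qed.

Lemma has_normal_form_ginv r :
  e != 0 -> has_normal_form r -> has_normal_form (r * g').
Proof.
move=> e_neq0 red_r.
have -> : r * g' = e^-1 *: r + - e^-1 *: (r * h).
  rewrite hE mulrBr mulr1 -scalerAr scalerBr scalerA mulNr mulVf //.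
  by rewrite !scaleNr scale1r opprK addrA subrr add0r.
by apply: has_normal_formD; apply: has_normal_formZ => //; apply: has_normal_form_h.
Qed.

(** The product [x g^-1] and not x itself: modulo [theta] the element x is
    [- t (g - e)], which is not a polynomial in h, while [x g^-1] is [- t h]. *)
Lemma has_normal_form_xg' r : has_normal_form r -> has_normal_form (r * (x * g')).
Proof.
move=> red_r; apply: (@has_normal_form_mod _ (- t *: (r * h))).
  rewrite xg'E mulrBr -scalerAr scaleNr opprK subrK.
  by apply: JMl; apply: JMr.
by apply: has_normal_formZ; apply: has_normal_form_h.
Qed.

(** Moving y to the left of a power of h only translates it. *)
Lemma has_normal_form_y r : has_normal_form r -> has_normal_form (r * y).
Proof.
move=> [P JP]; apply: (@has_normal_form_mod _ (eval_yh P * y)).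
  by rewrite -mulrBl; apply: JMr.
elim/poly_ind: P {JP} => [|P f IHP].
  by exists 0; rewrite /eval_yh rmorph0 horner0 mul0r subrr.
rewrite eval_yh_MXaddC mulrDl; apply: has_normal_formD; last first.
  exists (f * 'X)%:P; rewrite eval_yhC /eval_y rmorphM /= horner_algX subrr //.
rewrite -mulrA h_y.
apply: (@has_normal_form_mod _ (eval_yh P * y * h + - (t * e) *: (eval_yh P * h))).
  rewrite mulrDr mulrBl mulrBr mulr_algl -scalerAr scaleNr mulrA addrAC subrr add0r.
  by apply: JMl; rewrite -mulr_algl; do 2!apply: JMl.
apply: has_normal_formD; first exact: has_normal_form_h.
by apply: has_normal_formZ; exists (P * 'X); rewrite eval_yh_MX subrr.
Qed.

Lemma x_ginv_pow N : x * g' ^+ N = g' ^+ N * x.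
Proof. by apply: commrX; exact/esym/ginv_x. Qed.

Lemma y_ginv_pow N : y * g' ^+ N = g' ^+ N * (y + x *+ N).
Proof.
elim: N => [|N IHN]; first by rewrite !expr0 mulr1 mul1r mulr0n addr0.
rewrite exprS mulrA ginv_y -mulrA mulrDl IHN -mulrA; congr (_ * _).
rewrite x_ginv_pow.
by rewrite -mulrDr -addrA -mulrSr.
Qed.

(** Polynomials in h do not include g, which is [e (1 - h)^-1]; a power of g^-1
    on the right clears these denominators. Appending x or y to a word costs
    one more factor g^-1, since g^-N moves past them by [y_ginv_pow]. *)
Lemma normal_form r : e != 0 -> exists N, has_normal_form (r * g' ^+ N).
Proof.
move=> e_neq0.
have up r' N M :
    has_normal_form (r' * g' ^+ N) -> has_normal_form (r' * g' ^+ (N + M)).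
  by elim: M => [|M IHM]; rewrite ?addn0 // addnS exprSr mulrA => /IHM;
     apply: has_normal_form_ginv.
elim/word_ind: r => [|r s [N red_r] [M red_s]|c r [N red_r]|r [N red_r]].
- by exists 0%N, 1; rewrite mul1r expr0 eval_yhC /eval_y rmorph1 subrr.
- exists (N + M)%N; rewrite mulrDl; apply: has_normal_formD; first exact: up.
  by rewrite addnC; exact: up.
- by exists N; rewrite -scalerAl; exact: has_normal_formZ.
split.
- by exists N.+1; rewrite exprS -mulrA [g * _]mulrA gK mul1r.
- by exists N; rewrite -mulrA -exprS exprSr mulrA; apply: has_normal_form_ginv.
- exists N.+1; rewrite exprSr mulrA -[r * x * _]mulrA x_ginv_pow mulrA -mulrA.
  exact: has_normal_form_xg'.
exists N.+1; rewrite exprSr mulrA -[r * y * _]mulrA y_ginv_pow mulrA.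
rewrite -mulrA mulrDl mulrDr; apply: has_normal_formD.
  by rewrite mulrA; apply/has_normal_form_ginv/has_normal_form_y.
rewrite mulrnAl mulrnAr -scaler_nat; apply: has_normal_formZ.
exact: has_normal_form_xg'.
Qed.

(** * Cyclic modules generated by a common eigenvector *)
Section CyclicModule.
Variables (nu : k) (M : lmodType R) (v : M).
Implicit Types (m : M) (f : {poly k}) (P Q : {poly {poly k}}).
Hypotheses (char0 : [pchar k] =i pred0) (t_neq0 : t != 0) (nu_neq0 : nu != 0)
  (nu_neqe : nu != e).
Hypotheses (theta_v : theta *: v = 0) (g_v : g *: v = nu%:A *: v)
  (v_neq0 : v != 0) (v_cyclic : forall m, exists r, m = r *: v).

Let e_neq0 : e != 0.
Proof. by apply: contra_eqN e2E => /eqP->; rewrite expr0n eq_sym oner_eq0. Qed.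

Let te_neq0 : t * e != 0. Proof. by rewrite mulf_neq0. Qed.

Let c := 1 - e / nu.

Let c_neq0 : c != 0.
Proof.
by rewrite subr_eq0 -(inj_eq (mulIf nu_neq0)) mul1r divfK.
Qed.

(** Normality moves [theta] to the right of any [r], where it meets v. *)
Lemma theta_kills m : theta *: m = 0.
Proof.
have [r ->] := v_cyclic m; have [u ru] := theta_normal r.
by rewrite scalerA ru -scalerA theta_v scaler0.
Qed.

Lemma ideal_kills r m : J r -> r *: m = 0.
Proof.
move=> /(_ [set r | forall m : M, r *: m = 0]) Jr; apply: (Jr _ m).
split; last by move=> _ -> /=; exact: theta_kills.
split=> /=.
- by move=> m'; rewrite scale0r.
- by move=> u w Ku Kw m'; rewrite scalerBl Ku Kw subrr.
- by move=> a u Ku m'; rewrite -scalerA Ku scaler0.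
- by move=> a u Ku m'; rewrite -scalerA Ku.
Qed.

Lemma ginv_v : g' *: v = nu^-1%:A *: v.
Proof.
have vE : v = nu%:A *: (g' *: v).
  by rewrite scalerA mulr_algl -mulr_algr -scalerA -g_v scalerA ginvK scale1r.
have nuK : nu^-1%:A * nu%:A = 1 :> R.
  by rewrite mulr_algl scalerA mulVf // scale1r.
by rewrite [in RHS]vE scalerA nuK scale1r.
Qed.

Lemma scalar_act (a : k) r m : (a *: r) *: m = a%:A *: (r *: m).
Proof. by rewrite scalerA mulr_algl. Qed.

Lemma scalar_actM (a b : k) m : a%:A *: (b%:A *: m) = (a * b)%:A *: m.
Proof. by rewrite scalerA mulr_algl scalerA. Qed.

Lemma act_scalar (a : k) r m : r *: (a%:A *: m) = (a *: r) *: m.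
Proof. by rewrite scalerA mulr_algr. Qed.

Lemma h_v : h *: v = c%:A *: v.
Proof.
rewrite hE scalerBl scale1r scalar_act ginv_v scalar_actM.
by rewrite [c%:A]scalerBl scale1r [RHS]scalerBl scale1r.
Qed.

Lemma h_y_act m : h *: (y *: m) = (y - (t * e)%:A) *: (h *: m).
Proof.
rewrite !scalerA h_y scalerDl scalar_act -[(g' * _) *: _]scalerA theta_kills.
by rewrite !scaler0 addr0.
Qed.

Lemma h_eval_y f m : h *: (eval_y f *: m) = eval_y (pshift (t * e) f) *: (h *: m).
Proof.
elim/poly_ind: f m => [|f a IHf] m.
  by rewrite /pshift comp_poly0 /eval_y rmorph0 !scale0r scaler0.
have eval_yE q b : eval_y (q * ('X - b%:P) + a%:P) = eval_y q * (y - b%:A) + a%:A.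
  by rewrite /eval_y rmorphD rmorphM raddfB /= horner_algX !horner_algC.
have eval_yX q : eval_y (q * 'X + a%:P) = eval_y q * y + a%:A.
  by rewrite /eval_y rmorphD rmorphM /= horner_algX horner_algC.
rewrite pshift_MXaddC eval_yE eval_yX.
rewrite [in LHS]scalerDl [in RHS]scalerDl scalerDr -[(_ * y) *: m]scalerA IHf.
rewrite h_y_act -[(_ * (y - _)) *: _]scalerA; congr (_ + _).
by rewrite act_scalar -scalar_act.
Qed.

Lemma h_eval_y_v f : h *: (eval_y f *: v) = eval_y (c *: pshift (t * e) f) *: v.
Proof. by rewrite h_eval_y h_v act_scalar eval_yZ. Qed.

(** The key formula: [h - c] acts on the polynomials as a difference
    operator. *)
Lemma hc_eval_y_v f :
  (h - c%:A) *: (eval_y f *: v) = eval_y (c *: pdiff (t * e) f) *: v.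
Proof.
by rewrite scalerBl h_eval_y_v -scalar_act -scalerBl -eval_yZ -eval_yB -scalerBr.
Qed.

Lemma eval_yh_v P : eval_yh P *: v = eval_y P.[c%:P] *: v.
Proof.
elim/poly_ind: P => [|P f IHP].
  by rewrite /eval_yh rmorph0 !horner0 /eval_y rmorph0.
rewrite eval_yh_MXaddC hornerMXaddC scalerDl -scalerA h_v act_scalar scalar_act IHP.
rewrite [_ * c%:P]mulrC mul_polyC eval_yD eval_yZ [RHS]scalerDl.
by rewrite -scalar_act.
Qed.

(** On v the powers of g^-1 and h act by scalars, so a normal form for [r] yields
    a polynomial in y alone. *)
Lemma eval_y_v_surj m : exists f, m = eval_y f *: v.
Proof.
have [r ->] := v_cyclic m; have [N [P JP]] := normal_form r e_neq0.
have ginvN_v n : g' ^+ n *: v = (nu^-1 ^+ n)%:A *: v.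
  elim: n => [|n IHn]; first by rewrite !expr0 !scale1r.
  by rewrite exprS -scalerA IHn act_scalar scalar_act ginv_v scalar_actM exprSr.
exists (nu ^+ N *: P.[c%:P]).
have /eqP := ideal_kills v JP.
rewrite scalerBl subr_eq0 eval_yh_v -scalerA ginvN_v act_scalar => /eqP rE.
rewrite eval_yZ scalar_act -rE [(_ *: r) *: v]scalar_act scalar_actM exprVn mulfV.
  by rewrite !scale1r.
by rewrite expf_neq0.
Qed.

(** Each application of [h - c] lowers the degree of [f] by one and keeps it
    nonzero, until a nonzero constant is left. *)
Lemma submodule_generator (N : M -> Prop) f :
  (forall a (m n : M), N m -> N n -> N (a *: m + n)) -> N 0 ->
  f != 0 -> N (eval_y f *: v) -> N v.
Proof.
move=> NL N0; have NZ a m : N m -> N (a *: m).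
  by move=> Nm; rewrite -[a *: m]addr0; apply: NL.
have [n] := ubnP (size f); elim: n f => // n IHn f.
rewrite ltnS => size_f f_neq0 Nf.
have [|size_gt1] := leqP (size f) 1.
  move=> /size1_polyC fE; move: f_neq0 Nf; rewrite fE polyC_eq0 => f0_neq0.
  rewrite /eval_y horner_algC => /(NZ ((f`_0)^-1)%:A).
  by rewrite scalar_actM mulVf ?scale1r.
apply: (IHn (c *: pdiff (t * e) f)); last by rewrite -hc_eval_y_v; apply: NZ.
  rewrite size_scale //; apply: leq_trans size_f.
  rewrite -(ltn_predK size_gt1) ltnS; apply: size_pdiff.
  by rewrite (ltn_predK size_gt1).
by rewrite scaler_eq0 negb_or c_neq0 pdiff_neq0.
Qed.

(** Otherwise the zero submodule would contain v. *)
Lemma eval_y_v_inj f : eval_y f *: v = 0 -> f = 0.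
Proof.
move=> f_v; apply/eqP; apply: contraNT v_neq0 => f_neq0; apply/eqP.
apply: (@submodule_generator (fun m => m = 0) f) => // a m n -> ->.
by rewrite scaler0 addr0.
Qed.

Lemma hc_surj m : exists n : M, m = (h - c%:A) *: n.
Proof.
have [f ->] := eval_y_v_surj m.
have [F FE] := pdiff_surj char0 te_neq0 (c^-1 *: f).
by exists (eval_y F *: v); rewrite hc_eval_y_v FE scalerA mulfV // scale1r.
Qed.

(** Since [P] kills v, it vanishes at [h = c] as a polynomial in y, so the factor
    [h - c] splits off on the right; surjectivity of [h - c] passes the hypothesis
    to the cofactor. *)
Lemma eval_yh_faithful P : (forall m, eval_yh P *: m = 0) -> P = 0.
Proof.
have [n] := ubnP (size P); elim: n P => // n IHn P.
rewrite ltnS => size_P killP.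
have /factor_theorem[Q PE] : root P c%:P.
  by apply/rootP/eval_y_v_inj; rewrite -eval_yh_v.
have [Q0|Q_neq0] := eqVneq Q 0; first by rewrite PE Q0 mul0r.
rewrite PE (IHn Q) ?mul0r // => [|m].
  apply: leq_trans size_P; rewrite PE size_Mmonic ?monicXsubC //.
  by rewrite size_XsubC addn2.
have [m' ->] := hc_surj m; rewrite scalerA -[RHS](killP m') PE; congr (_ *: _).
by rewrite eval_yh_MXsubC.
Qed.

Lemma simple_cyclic : simple_module M.
Proof.
split; first by exists v.
move=> N [N0 NL].
have NL' a m n : N m -> N n -> N (a *: m + n).
  by move=> Nm Nn; have := NL a m n; rewrite !inE; apply.
have N0' : N 0 by move: N0; rewrite inE.
have [[m [Nm m_neq0]]|N_eq0] := pselect (exists m, N m /\ m != 0); [right|left].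
  apply/seteqP; split => // m' _.
  have [f mE] := eval_y_v_surj m; have [r ->] := v_cyclic m'.
  rewrite -[_ *: _]addr0; apply: (NL') => //.
  have f_neq0 : f != 0.
    apply: contraTneq m_neq0 => f0.
    by rewrite mE f0 /eval_y rmorph0 scale0r eqxx.
  by apply: (submodule_generator NL' N0' f_neq0); rewrite -mE.
apply/seteqP; split => [m Nm|_ ->] //=.
by apply: contrapT => /eqP m_neq0; apply: N_eq0; exists m.
Qed.

Lemma annihilator_cyclic : annihilator M = J.
Proof.
apply/seteqP; split => r /=; last by move=> Jr m; apply: ideal_kills.
move=> ann_r; have [N [P JP]] := normal_form r e_neq0.
have P0 : P = 0.
  apply: eval_yh_faithful => m; have /eqP := ideal_kills m JP.
  by rewrite scalerBl -scalerA ann_r sub0r oppr_eq0 => /eqP.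
have gN : g' ^+ N * g ^+ N = 1.
  by rewrite -exprMn_comm ?ginvK ?expr1n // /GRing.comm gK ginvK.
move: JP; rewrite P0 /eval_yh rmorph0 horner0 subr0 => /(JMr (g ^+ N)).
by rewrite -mulrA gN mulr1.
Qed.

End CyclicModule.
End Algebra.

(** * The modules over U *)
Section QuotientGenerator.
Variables (R : pzRingType) (a b : R).
Local Notation Q := (quot_left_ideal2 a b).
Local Notation v := (\pi_Q 1).

Lemma quot_scale_generator r : r *: v = \pi_Q r.
Proof. by rewrite [LHS]quot_scale_pi mulr1. Qed.

Lemma quot_generator_killed r : r \in left_ideal2 a b -> r *: v = 0.
Proof.
move=> Jr; rewrite quot_scale_generator -[RHS](raddf0 \pi_Q); apply/eqP.
by rewrite quot_eq subr0.
Qed.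

Lemma quot_generator_cyclic (m : Q) : exists r, m = r *: v.
Proof. by elim/quotW: m => r; exists r; rewrite quot_scale_generator. Qed.

Lemma quot_generator_neq0 : (forall r s, 1 <> r * a + s * b) -> v != 0.
Proof.
move=> proper; rewrite -[0](raddf0 \pi_Q) quot_eq subr0.
by apply/asboolP => -[r [s]]; exact: proper.
Qed.

Lemma left_generator_killed : a *: v = 0.
Proof.
apply: quot_generator_killed; apply/asboolP.
by exists 1, 0; rewrite mul1r mul0r addr0.
Qed.

Lemma right_generator_killed : b *: v = 0.
Proof.
apply: quot_generator_killed; apply/asboolP.
by exists 0, 1; rewrite mul1r mul0r add0r.
Qed.

End QuotientGenerator.

(** The common form of the four modules, with [a] the element [theta]. *)
Lemma U_quotient_spec (k : fieldType) (lam t e nu : k) (a b : U lam) :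
  [pchar k] =i pred0 -> lam != 0 -> t ^+ 2 = 2 * lam -> e ^+ 2 = 1 ->
  nu != 0 -> nu != e ->
  a = Ux lam + t *: (Ug lam - e%:A) -> b = Ug lam - nu%:A ->
  simple_module (quot_left_ideal2 a b) /\
  annihilator (quot_left_ideal2 a b) = ideal_gen [set a].
Proof.
move=> char0 lam_neq0 t2E e2E nu_neq0 nu_neqe aE bE.
have two_neq0 : 2 != 0 :> k by exact: natS_neq0.
have t_neq0 : t != 0.
  apply: contra_neq lam_neq0 => t0; move/eqP: t2E.
  by rewrite t0 expr0n eq_sym mulf_eq0 (negPf two_neq0) => /eqP.
have word_ind (P : U lam -> Prop) : P 1 ->
    (forall u v, P u -> P v -> P (u + v)) ->
    (forall (c : k) u, P u -> P (c *: u)) ->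
    (forall u, P u -> [/\ P (u * Ug lam), P (u * gen_U lam Gen_ginv),
       P (u * Ux lam) & P (u * Uy lam)]) -> forall u, P u.
  move=> P1 PD PZ PM; apply: (U_ind P1 PD PZ) => u i /PM[Pg Pg' Px Py].
  by case: i; [exact: Pg | exact: Pg' | exact: Px | exact: Py].
pose v : quot_left_ideal2 a b := \pi_(quot_left_ideal2 a b) 1.
have v_neq0 : v != 0.
  apply: quot_generator_neq0 => r s; rewrite aE bE.
  exact: U_left_ideal_proper.
have av := left_generator_killed a b.
have gv : Ug lam *: v = nu%:A *: v.
  by apply/eqP; rewrite -subr_eq0 -scalerBl -bE (right_generator_killed a b).
split.
  by apply: (simple_cyclic two_neq0 t2E e2E (U_gK lam) (U_ginvK lam)
    (U_gx lam) (U_gy lam) (U_yx lam) word_ind aE erefl char0 t_neq0 nu_neq0 nu_neqe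
    av gv v_neq0 (@quot_generator_cyclic _ a b)).
by apply: (annihilator_cyclic two_neq0 t2E e2E (U_gK lam) (U_ginvK lam)
    (U_gx lam) (U_gy lam) (U_yx lam) word_ind aE erefl char0 t_neq0 nu_neq0 nu_neqe
    av gv v_neq0 (@quot_generator_cyclic _ a b)).
Qed.

Theorem proposition4p10 (k : closedFieldType) (hk : [pchar k] =i pred0)
    (lam : k) (hlam : lam != 0) (s : k) (hs : s ^+ 2 = 2 * lam)
    (mu : k) (hmu0 : mu != 0) (hmu1 : mu != 1) :
  ([/\ simple_module (M_plus lam s mu),
       simple_module (M_minus lam s mu),
       annihilator (M_plus lam s mu) = ideal_gen [set phi_plus lam s]
     & annihilator (M_minus lam s mu) = ideal_gen [set phi_minus lam s]])
  /\
  ([/\ simple_module (V_plus lam s mu),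
       simple_module (V_minus lam s mu),
       annihilator (V_plus lam s mu) = ideal_gen [set psi_plus lam s]
     & annihilator (V_minus lam s mu) = ideal_gen [set psi_minus lam s]]).
Proof.
have hsN : (- s) ^+ 2 = 2 * lam by rewrite sqrrN.
have e1 : 1 ^+ 2 = 1 :> k by rewrite expr1n.
have eN1 : (- 1) ^+ 2 = 1 :> k by rewrite sqrrN expr1n.
have nu0 : - mu != 0 by rewrite oppr_eq0.
have nu1 : - mu != - 1 by rewrite eqr_opp.
have [|//|sM1 aM1] := U_quotient_spec (a := phi_plus lam s) (b := Ug lam - mu%:A)
  hk hlam hs e1 hmu0 hmu1.
  by rewrite /phi_plus scale1r.
have [|//|sM2 aM2] := U_quotient_spec (a := phi_minus lam s) (b := Ug lam - mu%:A)
  hk hlam hsN e1 hmu0 hmu1.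
  by rewrite /phi_minus scaleNr scale1r.
have [||sV1 aV1] := U_quotient_spec (a := psi_plus lam s) (b := Ug lam + mu%:A)
  hk hlam hs eN1 nu0 nu1.
- by rewrite /psi_plus scaleN1r opprK.
- by rewrite scaleNr opprK.
have [||sV2 aV2] := U_quotient_spec (a := psi_minus lam s) (b := Ug lam + mu%:A)
  hk hlam hsN eN1 nu0 nu1.
- by rewrite /psi_minus scaleNr scaleN1r opprK.
- by rewrite scaleNr opprK.
by split; [exact: And4 sM1 sM2 aM1 aM2 | exact: And4 sV1 sV2 aV1 aV2].
Qed.
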